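(* Any quadri-dendriform algebra can be embedded into an averaging dendriform algebra. More precisely, let $(\mathcal{D},\prec_\vdash,\prec_\dashv,\succ_\vdash,\succ_\dashv)$ be a quadri-dendriform algebra, with associated dendriform algebra $\mathcal{D}_{\mathrm{Dend}}=\mathcal{D}/I_{\mathcal{D}}$ and maps $\prec_l,\succ_l,\prec_r,\succ_r$ between $\mathcal{D}_{\mathrm{Dend}}$ and $\mathcal{D}$ as defined in the context. Then the direct sum $\mathcal{D}_{\mathrm{Dend}}\oplus\mathcal{D}$ is a dendriform algebra with the operations $$(\overline{x},x')\prec_\ltimes(\overline{y},y')=(\overline{x}\prec\overline{y},\ \overline{x}\prec_l y'+x'\prec_r\overline{y}),\qquad (\overline{x},x')\succ_\ltimes(\overline{y},y')=(\overline{x}\succ\overline{y},\ \overline{x}\succ_l y'+x'\succ_r\overline{y})$$ for $x,x',y,y'\in\mathcal{D}$; the map $$T:\mathcal{D}_{\mathrm{Dend}}\oplus\mathcal{D}\to\mathcal{D}_{\mathrm{Dend}}\oplus\mathcal{D},\qquad(\overline{x},y)\mapsto(\overline{y},0),$$ is an averaging operator on it, so that $(\mathcal{D}_{\mathrm{Dend}}\oplus\mathcal{D},T)$ is an averaging dendriform algebra; and the inclusion $i:\mathcal{D}\to\mathcal{D}_{\mathrm{Dend}}\oplus\mathcal{D}$, $x\mapsto(0,x)$, is an embedding of the quadri-dendriform algebra $\mathcal{D}$ into the averaging dendriform algebra $(\mathcal{D}_{\mathrm{Dend}}\oplus\mathcal{D},T)$, i.e. an injective homomorphism of quadri-dendriform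 algebras, where $\mathcal{D}_{\mathrm{Dend}}\oplus\mathcal{D}$ carries the quadri-dendriform structure induced by $T$.
   Context: Throughout, $\mathbb{K}$ is a field of characteristic zero; all vector spaces and (multi)linear maps are over $\mathbb{K}$, and all binary operations are bilinear. A dendriform algebra is a vector space $D$ with binary operations $\prec,\succ:D\otimes D\to D$ such that for all $x,y,z\in D$: $(x\prec y)\prec z=x\prec(y\prec z+y\succ z)$, $(x\succ y)\prec z=x\succ(y\prec z)$, $x\succ(y\succ z)=(x\prec y+x\succ y)\succ z$. An averaging operator on a dendriform algebra $(D,\prec,\succ)$ is a linear map $T:D\to D$ with $Tx\prec Ty=T(Tx\prec y)=T(x\prec Ty)$ and $Tx\succ Ty=T(Tx\succ y)=T(x\succ Ty)$ for all $x,y\in D$. An averaging dendriform algebra is a pair $(D,T)$ of a dendriform algebra and an averaging operator on it. The quadri-dendriform structure on $D$ induced by $T$ is $x\prec_\vdash^T y=Tx\prec y$, $x\prec_\dashv^T y=x\prec Ty$, $x\succ_\vdash^T y=Tx\succ y$, $x\succ_\dashv^T y=x\succ Ty$. A quadri-dendriform algebra is a vector space $\mathcal{D}$ with four binary operations $\prec_\vdash,\prec_\dashv,\succ_\vdash,\succ_\dashv$ such that for all $x,y,z\in\mathcal{D}$: (1) $(x\prec_\vdash y)\prec_\vdash z=(x\prec_\dashv y)\prec_\vdash z=x\prec_\vdash(y\prec_\vdash z+y\succ_\vdash z)$; (2) $(x\succ_\vdash y)\prec_\vdash z=(x\succ_\dashv y)\prec_\vdash z=x\succ_\vdash(y\prec_\vdash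 z)$; (3) $x\succ_\vdash(y\succ_\vdash z)=(x\prec_\vdash y+x\succ_\vdash y)\succ_\vdash z=(x\prec_\dashv y+x\succ_\dashv y)\succ_\vdash z=(x\prec_\vdash y+x\succ_\dashv y)\succ_\vdash z=(x\prec_\dashv y+x\succ_\vdash y)\succ_\vdash z$; (4) $(x\prec_\vdash y)\prec_\dashv z=x\prec_\vdash(y\prec_\dashv z+y\succ_\dashv z)$; (5) $(x\succ_\vdash y)\prec_\dashv z=x\succ_\vdash(y\prec_\dashv z)$; (6) $x\succ_\vdash(y\succ_\dashv z)=(x\prec_\vdash y+x\succ_\vdash y)\succ_\dashv z$; (7) $(x\prec_\dashv y)\prec_\dashv z=x\prec_\dashv(y\prec_\vdash z+y\succ_\vdash z)=x\prec_\dashv(y\prec_\dashv z+y\succ_\dashv z)=x\prec_\dashv(y\prec_\vdash z+y\succ_\dashv z)=x\prec_\dashv(y\prec_\dashv z+y\succ_\vdash z)$; (8) $(x\succ_\dashv y)\prec_\dashv z=x\succ_\dashv(y\prec_\vdash z)=x\succ_\dashv(y\prec_\dashv z)$; (9) $x\succ_\dashv(y\succ_\vdash z)=x\succ_\dashv(y\succ_\dashv z)=(x\prec_\dashv y+x\succ_\dashv y)\succ_\dashv z$. A homomorphism of quadri-dendriform algebras is a linear map compatible with the four operations. For a quadri-dendriform algebra $\mathcal{D}$, $I_{\mathcal{D}}$ is the vector subspace spanned by $\{x\prec_\vdash y-x\prec_\dashv y,\ x\succ_\vdash y-x\succ_\dashv y: x,y\in\mathcal{D}\}$ (it is an ideal),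 $\mathcal{D}_{\mathrm{Dend}}=\mathcal{D}/I_{\mathcal{D}}$, and $\overline{x}$ is the class of $x\in\mathcal{D}$. $\mathcal{D}_{\mathrm{Dend}}$ is a dendriform algebra with $\overline{x}\prec\overline{y}=\overline{x\prec_\vdash y}=\overline{x\prec_\dashv y}$ and $\overline{x}\succ\overline{y}=\overline{x\succ_\vdash y}=\overline{x\succ_\dashv y}$. The (well-defined) bilinear maps $\prec_l,\succ_l:\mathcal{D}_{\mathrm{Dend}}\times\mathcal{D}\to\mathcal{D}$ and $\prec_r,\succ_r:\mathcal{D}\times\mathcal{D}_{\mathrm{Dend}}\to\mathcal{D}$ are $\overline{x}\prec_l y=x\prec_\vdash y$, $\overline{x}\succ_l y=x\succ_\vdash y$, $y\prec_r\overline{x}=y\prec_\dashv x$, $y\succ_r\overline{x}=y\succ_\dashv x$. *)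

(* Defs.v *)
From HB Require Import structures.
From mathcomp Require Import all_boot all_algebra.
From mathcomp Require Import boolp.

Set Implicit Arguments.
Unset Strict Implicit.
Unset Printing Implicit Defensive.

Import GRing.Theory.
Local Open Scope ring_scope.
Local Open Scope quotient_scope.

Section LinearSpan.
Variables (K : fieldType) (V : lmodType K).

(* The vector subspace spanned by an arbitrary subset G of V, i.e. the set of
   finite linear combinations; it is made a boolean predicate classically, as
   the library's quotients require. *)
Definition lin_span (G : V -> Prop) : {pred V} :=
  fun x => `[< exists s : seq (K * V),
    (forall p, p \in s -> G p.2) /\ x = \sum_(p <- s) p.1 *: p.2 >].

Lemma lin_span_submod_closed (G : V -> Prop) : submod_closed (lin_span G).
Proof.
split=> [|a x y /asboolP[s [Gs ->]] /asboolP[t [Gt ->]]]; apply/asboolP.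
  by exists [::]; rewrite big_nil.
exists ([seq (a * p.1, p.2) | p <- s] ++ t); split.
  move=> p; rewrite mem_cat => /orP[/mapP[r rs ->]|]; last exact: Gt.
  exact: (Gs r).
rewrite big_cat big_map /= scaler_sumr; congr (_ + _).
by apply: eq_bigr => p _; rewrite scalerA.
Qed.

HB.instance Definition _ (G : V -> Prop) :=
  GRing.isSubmodClosed.Build K V (lin_span G) (lin_span_submod_closed G).

Lemma mem_lin_span (G : V -> Prop) x : G x -> x \in lin_span G.
Proof.
move=> Gx; apply/asboolP; exists [:: (1, x)]; rewrite big_seq1 scale1r.
by split=> // p; rewrite inE => /eqP ->.
Qed.

(* The quotient vector space V / span G: the library's quotient of the additive
   group V, with the scalar action a *: \pi x = \pi (a *: x). *)
Definition quot_span (G : V -> Prop) := Quotient.quot (lin_span G).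

Section Quot.
Variable G : V -> Prop.
Local Notation Q := (quot_span G).

HB.instance Definition _ := GRing.Zmodule.on Q.
HB.instance Definition _ := Quotient.on Q.

Lemma quot_spanP (x y : V) : (\pi_Q x = \pi_Q y) <-> (x - y \in lin_span G).
Proof. by rewrite (Quotient.idealrBE (lin_span G)); split=> /eqP. Qed.

Definition quot_scale (a : K) (u : Q) : Q := \pi_Q (a *: repr u).

Lemma quot_scale_pi a x : quot_scale a (\pi_Q x) = \pi_Q (a *: x).
Proof.
apply/quot_spanP; rewrite -scalerBr rpredZ //; apply/quot_spanP.
by rewrite reprK.
Qed.

Lemma quot_piD (x y : V) : \pi_Q (x + y) = \pi_Q x + \pi_Q y.
Proof. exact (@Quotient.pi_add _ (lin_span G) x y). Qed.

Fact quot_scaleA a b u : quot_scale a (quot_scale b u) = quot_scale (a * b) u.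
Proof. by elim/quotW: u => x; rewrite (quot_scale_pi b) !quot_scale_pi scalerA. Qed.

Fact quot_scale1 : left_id 1 quot_scale.
Proof. by elim/quotW=> x; rewrite quot_scale_pi scale1r. Qed.

Fact quot_scaleDr : right_distributive quot_scale +%R.
Proof.
move=> a; elim/quotW=> x; elim/quotW=> y.
by rewrite -quot_piD !quot_scale_pi scalerDr quot_piD.
Qed.

Fact quot_scaleDl u : {morph quot_scale^~ u : a b / a + b}.
Proof.
by elim/quotW: u => x a b; rewrite !quot_scale_pi scalerDl quot_piD.
Qed.

HB.instance Definition _ := GRing.Zmodule_isLmodule.Build K Q
  quot_scaleA quot_scale1 quot_scaleDr quot_scaleDl.

End Quot.
End LinearSpan.

Lemma lin_span_ker (K : fieldType) (V W : lmodType K) (G : V -> Prop)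
    (f : V -> W) :
  linear f -> (forall g, G g -> f g = 0) -> forall x, x \in lin_span G -> f x = 0.
Proof.
move=> lf fG x /asboolP[s [Gs ->]]; have f0 : f 0 = 0.
  by have := lf (-1) 0 0; rewrite scaler0 addr0 scaleN1r addNr.
elim: s Gs => [|p s IHs] Gs; first by rewrite big_nil.
rewrite big_cons lf fG ?scaler0 ?add0r; last by apply: Gs; rewrite mem_head.
by apply: IHs => r rs; apply: Gs; rewrite inE rs orbT.
Qed.

Definition bilinear_op (K : fieldType) (V : lmodType K) (op : V -> V -> V) :=
  (forall y, linear (op^~ y)) /\ (forall x, linear (op x)).

Record dend_ops (D : Type) := DendOps {
  dprec : D -> D -> D;
  dsucc : D -> D -> D
}.

(* The suffixes V and D stand for the indices \vdash and \dashv. *)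
Record quadri_ops (D : Type) := QuadriOps {
  qprecV : D -> D -> D;
  qprecD : D -> D -> D;
  qsuccV : D -> D -> D;
  qsuccD : D -> D -> D
}.

Section Dendriform.
Variables (K : fieldType) (D : lmodType K) (d : dend_ops D).

Local Notation "x ≺ y" := (dprec d x y) (at level 40).
Local Notation "x ≻ y" := (dsucc d x y) (at level 40).

Record is_dendriform : Prop := IsDendriform {
  dprec_bilinear : bilinear_op (dprec d);
  dsucc_bilinear : bilinear_op (dsucc d);
  dend_ax1 : forall x y z, (x ≺ y) ≺ z = x ≺ (y ≺ z + y ≻ z);
  dend_ax2 : forall x y z, (x ≻ y) ≺ z = x ≻ (y ≺ z);
  dend_ax3 : forall x y z, x ≻ (y ≻ z) = (x ≺ y + x ≻ y) ≻ z
}.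

Record is_averaging (T : D -> D) : Prop := IsAveraging {
  avg_linear : linear T;
  avg_prec : forall x y, T x ≺ T y = T (T x ≺ y) /\ T (T x ≺ y) = T (x ≺ T y);
  avg_succ : forall x y, T x ≻ T y = T (T x ≻ y) /\ T (T x ≻ y) = T (x ≻ T y)
}.

Record is_averaging_dendriform (T : D -> D) : Prop := IsAveragingDendriform {
  avg_dendriform : is_dendriform;
  avg_operator : is_averaging T
}.

Definition induced_quadri (T : D -> D) : quadri_ops D := {|
  qprecV := fun x y => T x ≺ y;
  qprecD := fun x y => x ≺ T y;
  qsuccV := fun x y => T x ≻ y;
  qsuccD := fun x y => x ≻ T y
|}.

End Dendriform.

Section QuadriDendriform.
Variables (K : fieldType) (D : lmodType K) (q : quadri_ops D).

Local Notation "x ≺⊢ y" := (qprecV q x y) (at level 40).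
Local Notation "x ≺⊣ y" := (qprecD q x y) (at level 40).
Local Notation "x ≻⊢ y" := (qsuccV q x y) (at level 40).
Local Notation "x ≻⊣ y" := (qsuccD q x y) (at level 40).

Record is_quadri_dendriform : Prop := IsQuadriDendriform {
  qprecV_bilinear : bilinear_op (qprecV q);
  qprecD_bilinear : bilinear_op (qprecD q);
  qsuccV_bilinear : bilinear_op (qsuccV q);
  qsuccD_bilinear : bilinear_op (qsuccD q);
  quadri_ax1 : forall x y z,
    (x ≺⊢ y) ≺⊢ z = (x ≺⊣ y) ≺⊢ z /\
    (x ≺⊣ y) ≺⊢ z = x ≺⊢ (y ≺⊢ z + y ≻⊢ z);
  quadri_ax2 : forall x y z,
    (x ≻⊢ y) ≺⊢ z = (x ≻⊣ y) ≺⊢ z /\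
    (x ≻⊣ y) ≺⊢ z = x ≻⊢ (y ≺⊢ z);
  quadri_ax3 : forall x y z,
    [/\ x ≻⊢ (y ≻⊢ z) = (x ≺⊢ y + x ≻⊢ y) ≻⊢ z,
        (x ≺⊢ y + x ≻⊢ y) ≻⊢ z = (x ≺⊣ y + x ≻⊣ y) ≻⊢ z,
        (x ≺⊣ y + x ≻⊣ y) ≻⊢ z = (x ≺⊢ y + x ≻⊣ y) ≻⊢ z
      & (x ≺⊢ y + x ≻⊣ y) ≻⊢ z = (x ≺⊣ y + x ≻⊢ y) ≻⊢ z];
  quadri_ax4 : forall x y z,
    (x ≺⊢ y) ≺⊣ z = x ≺⊢ (y ≺⊣ z + y ≻⊣ z);
  quadri_ax5 : forall x y z,
    (x ≻⊢ y) ≺⊣ z = x ≻⊢ (y ≺⊣ z);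
  quadri_ax6 : forall x y z,
    x ≻⊢ (y ≻⊣ z) = (x ≺⊢ y + x ≻⊢ y) ≻⊣ z;
  quadri_ax7 : forall x y z,
    [/\ (x ≺⊣ y) ≺⊣ z = x ≺⊣ (y ≺⊢ z + y ≻⊢ z),
        x ≺⊣ (y ≺⊢ z + y ≻⊢ z) = x ≺⊣ (y ≺⊣ z + y ≻⊣ z),
        x ≺⊣ (y ≺⊣ z + y ≻⊣ z) = x ≺⊣ (y ≺⊢ z + y ≻⊣ z)
      & x ≺⊣ (y ≺⊢ z + y ≻⊣ z) = x ≺⊣ (y ≺⊣ z + y ≻⊢ z)];
  quadri_ax8 : forall x y z,
    (x ≻⊣ y) ≺⊣ z = x ≻⊣ (y ≺⊢ z) /\
    x ≻⊣ (y ≺⊢ z) = x ≻⊣ (y ≺⊣ z);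
  quadri_ax9 : forall x y z,
    x ≻⊣ (y ≻⊢ z) = x ≻⊣ (y ≻⊣ z) /\
    x ≻⊣ (y ≻⊣ z) = (x ≺⊣ y + x ≻⊣ y) ≻⊣ z
}.

Definition quadri_ideal_gen (g : D) : Prop :=
  exists x y, g = x ≺⊢ y - x ≺⊣ y \/ g = x ≻⊢ y - x ≻⊣ y.

Definition quadri_ideal : {pred D} := lin_span quadri_ideal_gen.

Definition dend_quot : lmodType K := quot_span quadri_ideal_gen.

Definition dend_class (x : D) : dend_quot := \pi_(quot_span quadri_ideal_gen) x.

Definition dend_repr (u : dend_quot) : D :=
  repr (u : quot_span quadri_ideal_gen).

(* The operations on D / I_D and its actions on D are defined on chosen
   representatives; the lemmas at the end of this section show that for a
   quadri-dendriform algebra they do not depend on the choice. *)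
Definition dend_quot_ops : dend_ops dend_quot := {|
  dprec := fun u v => dend_class (dend_repr u ≺⊢ dend_repr v);
  dsucc := fun u v => dend_class (dend_repr u ≻⊢ dend_repr v)
|}.

Definition prec_l (u : dend_quot) (y : D) : D := dend_repr u ≺⊢ y.
Definition succ_l (u : dend_quot) (y : D) : D := dend_repr u ≻⊢ y.
Definition prec_r (y : D) (u : dend_quot) : D := y ≺⊣ dend_repr u.
Definition succ_r (y : D) (u : dend_quot) : D := y ≻⊣ dend_repr u.

Definition dend_sum : lmodType K := (dend_quot * D)%type.

Definition ltimes_ops : dend_ops dend_sum := {|
  dprec := fun p r => (dprec dend_quot_ops p.1 r.1,
                       prec_l p.1 r.2 + prec_r p.2 r.1);
  dsucc := fun p r => (dsucc dend_quot_ops p.1 r.1,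
                       succ_l p.1 r.2 + succ_r p.2 r.1)
|}.

Definition ltimes_avg (p : dend_sum) : dend_sum := (dend_class p.2, 0).

Definition ltimes_incl (x : D) : dend_sum := (0, x).

Lemma dend_classK u : dend_class (dend_repr u) = u.
Proof. exact: reprK. Qed.

Lemma dend_classP x y : dend_class x = dend_class y <-> x - y \in quadri_ideal.
Proof. exact: quot_spanP. Qed.

Lemma dend_class_linear : linear dend_class.
Proof.
by move=> a x y; rewrite /dend_class quot_piD -quot_scale_pi.
Qed.

Lemma dend_class_prec x y : dend_class (x ≺⊢ y) = dend_class (x ≺⊣ y).
Proof. by apply/dend_classP/mem_lin_span; exists x, y; left. Qed.

Lemma dend_class_succ x y : dend_class (x ≻⊢ y) = dend_class (x ≻⊣ y).
Proof. by apply/dend_classP/mem_lin_span; exists x, y; right. Qed.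

Section WellDefined.
Hypothesis hq : is_quadri_dendriform.

Let opBl (op : D -> D -> D) (h : bilinear_op op) x y z :
  op (x - y) z = op x z - op y z.
Proof. by rewrite addrC -scaleN1r h.1 scaleN1r addrC. Qed.

Let opBr (op : D -> D -> D) (h : bilinear_op op) x y z :
  op z (x - y) = op z x - op z y.
Proof. by rewrite addrC -scaleN1r h.2 scaleN1r addrC. Qed.

Let opDl (op : D -> D -> D) (h : bilinear_op op) x y z :
  op (x + y) z = op x z + op y z.
Proof. by have := h.1 z 1 x y; rewrite !scale1r. Qed.

Let opDr (op : D -> D -> D) (h : bilinear_op op) x y z :
  op z (x + y) = op z x + op z y.
Proof. by have := h.2 z 1 x y; rewrite !scale1r. Qed.

Let op_ideal_l (op : D -> D -> D) (h : bilinear_op op) z :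
  (forall x y, op (x ≺⊢ y) z = op (x ≺⊣ y) z) ->
  (forall x y, op (x ≻⊢ y) z = op (x ≻⊣ y) z) ->
  forall x x', dend_class x = dend_class x' -> op x z = op x' z.
Proof.
move=> hp hs x x' /dend_classP hx; apply/eqP; rewrite -subr_eq0 -opBl //.
apply/eqP; apply: (lin_span_ker (h.1 z) _ hx) => g [a [b [] ->]] /=;
  by rewrite opBl // (hp, hs) subrr.
Qed.

Let op_ideal_r (op : D -> D -> D) (h : bilinear_op op) z :
  (forall x y, op z (x ≺⊢ y) = op z (x ≺⊣ y)) ->
  (forall x y, op z (x ≻⊢ y) = op z (x ≻⊣ y)) ->
  forall x x', dend_class x = dend_class x' -> op z x = op z x'.
Proof.
move=> hp hs x x' /dend_classP hx; apply/eqP; rewrite -subr_eq0 -opBr //.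
apply/eqP; apply: (lin_span_ker (h.2 z) _ hx) => g [a [b [] ->]] /=;
  by rewrite opBr // (hp, hs) subrr.
Qed.

Lemma prec_lE x y : prec_l (dend_class x) y = x ≺⊢ y.
Proof.
apply: (op_ideal_l (qprecV_bilinear hq)); last exact: dend_classK.
  by move=> a b; case: (quadri_ax1 hq a b y).
by move=> a b; case: (quadri_ax2 hq a b y).
Qed.

Lemma succ_lE x y : succ_l (dend_class x) y = x ≻⊢ y.
Proof.
have h := qsuccV_bilinear hq.
apply: (op_ideal_l h); last exact: dend_classK.
  move=> a b; case: (quadri_ax3 hq a b y) => _ _; rewrite !(opDl h).
  by move=> e1 e2; move: (e1) => /addIr <-.
move=> a b; case: (quadri_ax3 hq a b y) => _; rewrite !(opDl h).
by move=> e1 e2 _; move: e1; rewrite e2 => /addrI.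
Qed.

Lemma prec_rE x y : prec_r y (dend_class x) = y ≺⊣ x.
Proof.
have h := qprecD_bilinear hq.
apply: (op_ideal_r h); last exact: dend_classK.
  move=> a b; case: (quadri_ax7 hq y a b) => _ _; rewrite !(opDr h).
  by move=> e1 e2; move: (e1) => /addIr <-.
move=> a b; case: (quadri_ax7 hq y a b) => _; rewrite !(opDr h).
by move=> e1 e2 _; move: e1; rewrite e2 => /addrI.
Qed.

Lemma succ_rE x y : succ_r y (dend_class x) = y ≻⊣ x.
Proof.
apply: (op_ideal_r (qsuccD_bilinear hq)); last exact: dend_classK.
  by move=> a b; case: (quadri_ax8 hq y a b).
by move=> a b; case: (quadri_ax9 hq y a b).
Qed.

Lemma dend_precE x y :
  dprec dend_quot_ops (dend_class x) (dend_class y) = dend_class (x ≺⊢ y).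
Proof.
rewrite /= -/(prec_l (dend_class x) _) prec_lE dend_class_prec.
by rewrite -/(prec_r x (dend_class y)) prec_rE -dend_class_prec.
Qed.

Lemma dend_succE x y :
  dsucc dend_quot_ops (dend_class x) (dend_class y) = dend_class (x ≻⊢ y).
Proof.
rewrite /= -/(succ_l (dend_class x) _) succ_lE dend_class_succ.
by rewrite -/(succ_r x (dend_class y)) succ_rE -dend_class_succ.
Qed.

End WellDefined.
End QuadriDendriform.

Arguments dend_class {K D} q x.
Arguments dend_repr {K D} q u.
Arguments dend_quot_ops {K D} q.
Arguments prec_l {K D} q u y.
Arguments succ_l {K D} q u y.
Arguments prec_r {K D} q y u.
Arguments succ_r {K D} q y u.
Arguments ltimes_ops {K D} q.
Arguments ltimes_avg {K D} q p.
Arguments ltimes_incl {K D} q x.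

(* Both ends are required to satisfy the quadri-dendriform axioms. *)
Record is_quadri_hom (K : fieldType) (D E : lmodType K) (q : quadri_ops D)
    (r : quadri_ops E) (f : D -> E) : Prop := IsQuadriHom {
  quadri_hom_dom : is_quadri_dendriform q;
  quadri_hom_cod : is_quadri_dendriform r;
  quadri_hom_linear : linear f;
  quadri_hom_precV : {morph f : x y / qprecV q x y >-> qprecV r x y};
  quadri_hom_precD : {morph f : x y / qprecD q x y >-> qprecD r x y};
  quadri_hom_succV : {morph f : x y / qsuccV q x y >-> qsuccV r x y};
  quadri_hom_succD : {morph f : x y / qsuccD q x y >-> qsuccD r x y}
}.

(* Main.v *)
Require Import Defs.
From mathcomp Require Import all_boot all_algebra.

(** The quotient by I_D is exactly what makes both actions of D_Dend on D well
    defined: a left factor of a \vdash operation, or a right factor of a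
    \dashv one, matters only through its class. Computing on representatives,
    an identity between elements of D_Dend (+) D therefore splits into two
    identities in D. The first components give a quadri-dendriform axiom read
    modulo I_D. In the second components each term has exactly one factor in D
    and the other two in D_Dend, and collecting the terms by the position of
    the factor in D gives three of the axioms of D. For the first dendriform
    identity these are [quadri_ax1], [quadri_ax4] and [quadri_ax7], when that
    factor is on the right, in the middle and on the left respectively; the
    second identity uses [quadri_ax2], [quadri_ax5] and [quadri_ax8], the third
    [quadri_ax3], [quadri_ax6] and [quadri_ax9] ([ltimes_dendriform]).

    The map T kills the summand D_Dend and sends D onto it by the class map, so
    T p acts on (0, y) as the class of the D-component of p acts on y. This
    makes T averaging ([ltimes_averaging]), because the class map is equivariant
    for the actions, and it makes the operations induced by T restrict to the
    given ones on the summand D, which is the homomorphism property of the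
    inclusion. That the target is itself quadri-dendriform holds for every
    averaging dendriform algebra ([induced_quadri_dendriform]). *)

Set Implicit Arguments.
Unset Strict Implicit.
Unset Printing Implicit Defensive.

Import GRing.Theory.
Local Open Scope ring_scope.

Section BilinearOp.
Variables (K : fieldType) (V : lmodType K) (op : V -> V -> V).
Hypothesis op_bil : bilinear_op op.

Lemma bilinear_opDl x y z : op (x + y) z = op x z + op y z.
Proof. by have := op_bil.1 z 1 x y; rewrite !scale1r. Qed.

Lemma bilinear_opDr x y z : op z (x + y) = op z x + op z y.
Proof. by have := op_bil.2 z 1 x y; rewrite !scale1r. Qed.

Lemma bilinear_op0l z : op 0 z = 0.
Proof. by apply/(addrI (op 0 z)); rewrite -bilinear_opDl !addr0. Qed.

Lemma bilinear_op0r z : op z 0 = 0.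
Proof. by apply/(addrI (op z 0)); rewrite -bilinear_opDr !addr0. Qed.

Lemma bilinear_op_precomp_l (f : V -> V) :
  linear f -> bilinear_op (fun x y => op (f x) y).
Proof.
by move=> f_lin; split=> [z a x y|z]; rewrite ?f_lin; [exact: op_bil.1|exact: op_bil.2].
Qed.

Lemma bilinear_op_precomp_r (f : V -> V) :
  linear f -> bilinear_op (fun x y => op x (f y)).
Proof.
by move=> f_lin; split=> [z|z a x y]; rewrite ?f_lin; [exact: op_bil.1|exact: op_bil.2].
Qed.

End BilinearOp.

(** Every quadri-dendriform axiom becomes a dendriform axiom with T applied to
    two of the three arguments. The alternatives listed within one axiom differ
    only in which factor of an inner product, itself under T, carries the other
    T; by the averaging identities each of them is the product in which both
    factors carry a T. *)
Lemma induced_quadri_dendriform (K : fieldType) (D : lmodType K)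
    (d : dend_ops D) (T : D -> D) :
  is_averaging_dendriform d T -> is_quadri_dendriform (induced_quadri d T).
Proof.
case=> -[bp bs ax1 ax2 ax3] [T_lin T_prec T_succ].
have TD x y : T (x + y) = T x + T y.
  by have := T_lin 1 x y; rewrite !scale1r.
have TpV x y : T (dprec d (T x) y) = dprec d (T x) (T y).
  by case: (T_prec x y).
have TpD x y : T (dprec d x (T y)) = dprec d (T x) (T y).
  by case: (T_prec x y) => -> ->.
have TsV x y : T (dsucc d (T x) y) = dsucc d (T x) (T y).
  by case: (T_succ x y).
have TsD x y : T (dsucc d x (T y)) = dsucc d (T x) (T y).
  by case: (T_succ x y) => -> ->.
have TE := (TD, TpV, TpD, TsV, TsD).
split=> /=; try exact: bilinear_op_precomp_l; try exact: bilinear_op_precomp_r;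
  by move=> x y z; rewrite ?TE ?ax1 ?ax2 ?ax3.
Qed.

Section SemidirectProduct.
Variables (K : fieldType) (D : lmodType K) (q : quadri_ops D).
Hypothesis hq : is_quadri_dendriform q.

Local Notation cl := (dend_class q).

Lemma ltimes_precE x x' y y' :
  dprec (ltimes_ops q) (cl x, x') (cl y, y') =
  (cl (qprecV q x y), qprecV q x y' + qprecD q x' y).
Proof. by rewrite -(dend_precE hq) -(prec_lE hq) -(prec_rE hq). Qed.

Lemma ltimes_succE x x' y y' :
  dsucc (ltimes_ops q) (cl x, x') (cl y, y') =
  (cl (qsuccV q x y), qsuccV q x y' + qsuccD q x' y).
Proof. by rewrite -(dend_succE hq) -(succ_lE hq) -(succ_rE hq). Qed.

Lemma dend_sum_ind (P : dend_sum q -> Prop) :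
  (forall x x', P (cl x, x')) -> forall p, P p.
Proof. by move=> Pcl [u x']; rewrite -(dend_classK u). Qed.

Lemma dend_sum_linE a x x' y y' :
  a *: ((cl x, x') : dend_sum q) + (cl y, y') =
  (cl (a *: x + y), a *: x' + y').
Proof. by rewrite dend_class_linear. Qed.

Lemma dend_classD x y : cl (x + y) = cl x + cl y.
Proof. by have := dend_class_linear q 1 x y; rewrite !scale1r. Qed.

Lemma dend_class0 : cl 0 = 0.
Proof. by apply/(addrI (cl 0)); rewrite -dend_classD !addr0. Qed.

Lemma dend_sumDE x x' y y' :
  ((cl x, x') : dend_sum q) + (cl y, y') = (cl (x + y), x' + y').
Proof. by rewrite dend_classD. Qed.

(** Both semidirect operations have this shape, [opV] being the \vdash and
    [opD] the \dashv operation of D. *)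
Lemma ltimes_bilinear (op opV opD : _ -> _ -> _) :
  bilinear_op opV -> bilinear_op opD ->
  (forall x x' y y', op (cl x, x') (cl y, y') =
     (cl (opV x y), opV x y' + opD x' y) :> dend_sum q) ->
  bilinear_op op.
Proof.
move=> bV bD opE; split.
  elim/dend_sum_ind=> z z' a; elim/dend_sum_ind=> x x'.
  elim/dend_sum_ind=> y y'.
  by rewrite dend_sum_linE !opE dend_sum_linE !bV.1 bD.1 scalerDr addrACA.
elim/dend_sum_ind=> z z' a; elim/dend_sum_ind=> x x'.
elim/dend_sum_ind=> y y'.
by rewrite dend_sum_linE !opE dend_sum_linE !bV.2 bD.2 scalerDr addrACA.
Qed.

Lemma ltimes_dendriform : is_dendriform (ltimes_ops q).
Proof.
have [bpV bpD bsV bsD ax1 ax2 ax3 ax4 ax5 ax6 ax7 ax8 ax9] := hq.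
have ltE := (ltimes_precE, ltimes_succE, dend_sumDE).
split.
- exact: ltimes_bilinear bpV bpD ltimes_precE.
- exact: ltimes_bilinear bsV bsD ltimes_succE.
- elim/dend_sum_ind=> x x'; elim/dend_sum_ind=> y y'; elim/dend_sum_ind=> z z'.
  have ax1E u v w := etrans (ax1 u v w).1 (ax1 u v w).2.
  have [ax7E _ _ _] := ax7 x' y z.
  rewrite !ltE !ax1E (bilinear_opDl bpD) ax4 ax7E addrA -(bilinear_opDr bpV).
  by rewrite [in RHS]addrACA.
- elim/dend_sum_ind=> x x'; elim/dend_sum_ind=> y y'; elim/dend_sum_ind=> z z'.
  have ax2E u v w := etrans (ax2 u v w).1 (ax2 u v w).2.
  rewrite !ltE !ax2E (bilinear_opDl bpD) ax5 (ax8 _ _ _).1 addrA.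
  by rewrite -(bilinear_opDr bsV).
- elim/dend_sum_ind=> x x'; elim/dend_sum_ind=> y y'; elim/dend_sum_ind=> z z'.
  have ax3E u v w : qsuccV q (qprecV q u v + qsuccV q u v) w =
      qsuccV q u (qsuccV q v w) by case: (ax3 u v w).
  have ax9E : qsuccD q x' (qsuccV q y z) =
      qsuccD q (qprecD q x' y + qsuccD q x' y) z.
    by rewrite (ax9 _ _ _).1 (ax9 _ _ _).2.
  rewrite !ltE !ax3E (bilinear_opDr bsV) ax6 ax9E -addrA.
  by rewrite -(bilinear_opDl bsD) addrACA.
Qed.

(** All three members of an averaging identity have D-component zero and have
    for D_Dend-component the class of the product of the two D-components, by
    equivariance of the class map. *)
Lemma ltimes_averaging : is_averaging (ltimes_ops q) (ltimes_avg q).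
Proof.
have [bpV bpD bsV bsD _ _ _ _ _ _ _ _ _] := hq.
split.
- move=> a; elim/dend_sum_ind=> x x'; elim/dend_sum_ind=> y y'.
  rewrite dend_sum_linE /ltimes_avg /= dend_class_linear.
  by congr (_, _); rewrite /= scaler0 addr0.
- elim/dend_sum_ind=> x x'; elim/dend_sum_ind=> y y'.
  rewrite /ltimes_avg !ltimes_precE /=.
  rewrite !(bilinear_op0l bpD, bilinear_op0r bpV) !(addr0, add0r).
  by rewrite -dend_class_prec.
- elim/dend_sum_ind=> x x'; elim/dend_sum_ind=> y y'.
  rewrite /ltimes_avg !ltimes_succE /=.
  rewrite !(bilinear_op0l bsD, bilinear_op0r bsV) !(addr0, add0r).
  by rewrite -dend_class_succ.
Qed.

Lemma ltimes_averaging_dendriform :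
  is_averaging_dendriform (ltimes_ops q) (ltimes_avg q).
Proof. by split; [exact: ltimes_dendriform|exact: ltimes_averaging]. Qed.

Lemma ltimes_incl_hom :
  is_quadri_hom q (induced_quadri (ltimes_ops q) (ltimes_avg q))
    (ltimes_incl q).
Proof.
have [bpV bpD bsV bsD _ _ _ _ _ _ _ _ _] := hq.
have inclE x : ltimes_incl q x = (cl 0, x) by rewrite dend_class0.
have op0E := (bilinear_op0l bpV, bilinear_op0r bpV, bilinear_op0l bpD,
  bilinear_op0r bpD, bilinear_op0l bsV, bilinear_op0r bsV,
  bilinear_op0l bsD, bilinear_op0r bsD).
split=> //.
- exact: induced_quadri_dendriform ltimes_averaging_dendriform.
- by move=> a x y; rewrite !inclE dend_sum_linE scaler0 addr0.
- move=> x y; rewrite !inclE; apply/esym/(etrans (ltimes_precE x 0 0 y)).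
  by rewrite !op0E addr0.
- move=> x y; rewrite !inclE; apply/esym/(etrans (ltimes_precE 0 x y 0)).
  by rewrite !op0E add0r.
- move=> x y; rewrite !inclE; apply/esym/(etrans (ltimes_succE x 0 0 y)).
  by rewrite !op0E addr0.
- move=> x y; rewrite !inclE; apply/esym/(etrans (ltimes_succE 0 x y 0)).
  by rewrite !op0E add0r.
Qed.

End SemidirectProduct.

Theorem mainTheorem4 (K : fieldType) (charK0 : [pchar K]%R =i pred0)
    (D : lmodType K) (q : quadri_ops D) (hq : is_quadri_dendriform q) :
  is_averaging_dendriform (ltimes_ops q) (ltimes_avg q) /\
  is_quadri_hom q (induced_quadri (ltimes_ops q) (ltimes_avg q)) (ltimes_incl q) /\
  injective (ltimes_incl q).
Proof.
split; first exact: ltimes_averaging_dendriform.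
by split; [exact: ltimes_incl_hom|move=> x y []].
Qed.
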